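(* Fix an integer $k\ge 1$ and a sample path (a realization of the arrival times) of the $G/D/1/k$ queue on $[0,t_f]$. Let $\Delta L(k):=L(k+1)-L(k)$, let $L_c'(k):=-sN$, and let $E(k):=|\Delta L(k)-L_c'(k)|$, where $L(\cdot)$, $N$ and $N_s$ are as defined in the context. Then $$E(k)\ \le\ s\,N_s .$$
   Context: Queue: a single-server finite-buffer queue observed on a finite horizon $[0,t_f]$. Jobs arrive at the times of a given arrival sequence, are served in order of arrival, and each has the same constant service time $s>0$. For an integer $k\ge 1$, $x(k,t)$ denotes the number of jobs at the queue (server plus buffer) at time $t$ when the buffer-size parameter is $k$ throughout $[0,t_f]$; the queue is empty at time $0$. A job arriving at time $t$ when $x(k,t^-)=k$ (full buffer) is lost; otherwise it is admitted. Let $n(k)$ be the number of jobs lost during $[0,t_f]$ and let $L(k):=s\,n(k)$ be the loss volume. The quantities $L(k)$ and $L(k+1)$ are evaluated on the same sample path (the same arrival times); the trajectory $x(k,\cdot)$ is called nominal. A busy period (according to the nominal trajectory) is a maximal interval on which $x(k,\cdot)>0$; an idle period is a maximal interval on which $x(k,\cdot)=0$ (the initial empty interval starting at time $0$ counts as the idle period preceding the first busy period). A busy period is lossy if at least one job is lost during it. $N$ is the number of lossy busy periods of the nominal trajectory in $[0,t_f]$, and $N_s$ is the number of those lossy busy periods whose preceding idle period is shorter than $s$. The quantity $L_c'(k)=-sN$ is the infinitesimal perturbation analysis (IPA) derivative of the loss volume obtained from a stochastic flow model of the queue, evaluated on the nominal sample path of the discrete queue. *)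

(* Defs.v *)
From HB Require Import structures.
From mathcomp Require Import all_boot all_order all_algebra finmap.
From mathcomp Require Import all_classical all_reals all_analysis.

Set Implicit Arguments.
Unset Strict Implicit.
Unset Printing Implicit Defensive.

Import Order.TTheory GRing.Theory Num.Theory.
Import numFieldNormedType.Exports.
Local Open Scope classical_set_scope.
Local Open Scope ring_scope.

(* An admitted job is the pair (arrival time, departure time). *)
Definition jobs_at (R : realType) (adm : seq (R * R)) (t : R) : nat :=
  count (fun j => j.1 <= t < j.2) adm.

(* The left limit at t of [jobs_at adm] (see [jobs_before_left_limit]): a job
   that departs exactly at t is still counted. *)
Definition jobs_before (R : realType) (adm : seq (R * R)) (t : R) : nat :=
  count (fun j => j.1 < t <= j.2) adm.

Lemma jobs_before_left_limit (R : realType) (adm : seq (R * R)) (t : R) :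
  \forall u \near t^'-, jobs_at adm u = jobs_before adm t.
Proof.
have le_near (c : R) : \forall u \near t^'-, (c <= u) = (c < t).
  have [c_t|t_c] := ltP c t.
    by apply: filterS (nbhs_left_gt c_t) => u /ltW.
  apply: filterS (nbhs_left_lt t) => u ut.
  by apply/negbTE; rewrite -ltNge (lt_le_trans ut).
elim: adm => [|[a d] adm IH]; first exact: nearW.
near=> u.
have eqadm : jobs_at adm u = jobs_before adm t by near: u; exact: IH.
have ea : (a <= u) = (a < t) by near: u; exact: le_near.
have ed : (d <= u) = (d < t) by near: u; exact: le_near.
by move: eqadm; rewrite /jobs_at /jobs_before /= ea (ltNge u d) ed -leNgt => ->.
Unshelve. all: by end_near. Qed.

(* Processes a job arriving at t, given the admitted jobs (in order of arrival)
   and the arrival times of the lost jobs so far.  An admitted job starts its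
   service at t or when the previously admitted job departs, if that is later. *)
Definition arrive (R : realType) (s : R) (k : nat)
    (h : seq (R * R) * seq R) (t : R) : seq (R * R) * seq R :=
  if jobs_before h.1 t == k then (h.1, rcons h.2 t)
  else (rcons h.1 (t, Num.max t (last t (unzip2 h.1)) + s), h.2).

Definition history (R : realType) (s : R) (k : nat) (arr : seq R) :
    seq (R * R) * seq R :=
  foldl (arrive s k) ([::], [::]) arr.

Definition lost_jobs (R : realType) (s : R) (k : nat) (arr : seq R) : seq R :=
  (history s k arr).2.

Definition x (R : realType) (s : R) (arr : seq R) (k : nat) (t : R) : nat :=
  jobs_at (history s k arr).1 t.

Definition loss_volume (R : realType) (s : R) (arr : seq R) (k : nat) : R :=
  s * (size (lost_jobs s k arr))%:R.

Definition maximal_interval_in (R : realType) (D I : set R) : Prop :=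
  [/\ I !=set0, is_interval I, I `<=` D &
      forall J : set R, is_interval J -> J `<=` D -> I `<=` J -> J = I].

Definition busy_period (R : realType) (s tf : R) (arr : seq R) (k : nat)
    (I : set R) : Prop :=
  maximal_interval_in [set t | 0 <= t <= tf /\ (0 < x s arr k t)%N] I.

Definition idle_period (R : realType) (s tf : R) (arr : seq R) (k : nat)
    (J : set R) : Prop :=
  maximal_interval_in [set t | 0 <= t <= tf /\ x s arr k t = 0%N] J.

(* Since x is right-continuous, busy periods ending before tf have the form
   [b, e[.  The closure accounts for a job lost at the instant e itself: this
   happens for k = 1, when a job arrives exactly as the only job departs. *)
Definition lossy_busy_period (R : realType) (s tf : R) (arr : seq R) (k : nat)
    (I : set R) : Prop :=
  busy_period s tf arr k I /\
  exists2 t, t \in lost_jobs s k arr & closure I t.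

Definition preceding_idle_period (R : realType) (s tf : R) (arr : seq R)
    (k : nat) (I J : set R) : Prop :=
  idle_period s tf arr k J /\ sup J = inf I.

(* Both sets below are finite, as x is a step function with finitely many jumps
   ([fset_set] would send an infinite set to the empty one). *)
Definition N (R : realType) (s tf : R) (arr : seq R) (k : nat) : nat :=
  #|` fset_set [set I | lossy_busy_period s tf arr k I] |%fset.

Definition N_s (R : realType) (s tf : R) (arr : seq R) (k : nat) : nat :=
  #|` fset_set [set I | lossy_busy_period s tf arr k I /\
        exists2 J, preceding_idle_period s tf arr k I J & sup J - inf J < s]
  |%fset.

Definition Delta_L (R : realType) (s : R) (arr : seq R) (k : nat) : R :=
  loss_volume s arr k.+1 - loss_volume s arr k.

Definition ipa_derivative (R : realType) (s tf : R) (arr : seq R) (k : nat) : R :=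
  - s * (N s tf arr k)%:R.

Definition E (R : realType) (s tf : R) (arr : seq R) (k : nat) : R :=
  `| Delta_L s arr k - ipa_derivative s tf arr k |.

(* Main.v *)
From HB Require Import structures.
Require Import Defs.
From mathcomp Require Import all_boot all_order all_algebra finmap.
From mathcomp Require Import all_classical all_reals all_analysis.
From mathcomp Require Import lra zify.
Import Order.TTheory GRing.Theory Num.Theory.
Import numFieldNormedType.Exports.
Local Open Scope ring_scope.

(** With a constant service time, the state of either queue just before an
arrival at [t] is a function of the time [d] at which its last admitted job
departs: the departures still to come are d, d - s, d - 2s, and so on, so that
the buffer of size k is full exactly when t + (k - 1)s <= d ([full_bufferE]).
The two queues thus reduce to two scalars driven by the same arrivals, [d] for
the size k and [d'] for the size k + 1, each of which becomes max(t, d) + s at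
an admission and stays put at a loss.

Let D = d' - d.  A loss suffered by the nominal queue only raises D by s and
requires D < s; a loss suffered by the larger queue only lowers D by s and
requires D >= s; a common loss requires D > 0; an idle period of length g
replaces D by max(0, D - g).  Hence 0 <= D < 2s throughout.

Let G be the number of losses avoided by the larger buffer.  The claim is
N - N_s <= G <= N.  Within a nominal busy period D takes at most two values,
differing by s, so a period contributes at most 1 to G, and at most 0 if it is
not lossy: this gives G <= N.  A lossy period contributes exactly 1 if it begins
with D = 0.  If it begins with D > 0 it may contribute less, even when the
preceding idle period is longer than s, because D may have exceeded s at the
end of the previous period.  The lower bound therefore needs an amortized
argument: the slack N_s - (N - G) never becomes negative, and it is at least 1
whenever D > s.  Indeed D can exceed s only through a lossy period that begins
with 0 < D; its preceding idle period is then either short, which adds 1 to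
the slack, or long, in which case D already exceeded s before it.  The predicate
[balanced] carries both bounds from one arrival to the next.

It remains to identify N and N_s with counts along the recursion.  The nominal
busy periods are collected in a list [busy_periods] together with the idle
interval before each of them; the corresponding real intervals are shown to be
the maximal busy and idle intervals ([maximal_busy_interval],
[maximal_idle_interval]), which gives [N_count] and [N_s_count]. *)

Set Implicit Arguments.
Unset Strict Implicit.
Unset Printing Implicit Defensive.

(** * The last departure determines the state of a queue *)

(** An empty history is given the departure time [- s]: this virtual job leaves
the queue empty from time 0 on, and the idle period that it opens has length at
least [s], hence never counts as short. *)
Definition last_departure (R : realType) (s : R) (h : seq (R * R) * seq R) : R :=
  last (- s) (unzip2 h.1).

Lemma history_rcons (R : realType) (s : R) (k : nat) (arr : seq R) (t : R) :
  history s k (rcons arr t) = arrive s k (history s k arr) t.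
Proof. by rewrite /history foldl_rcons. Qed.

(** What makes the last departure a complete description of the state after the
arrivals up to [T]: for [t] later than [T], the jobs present just before [t]
correspond to the terms [d - m * s] that are at least [t]. *)
Definition tracks (R : realType) (s : R) (k : nat)
    (h : seq (R * R) * seq R) (T : R) : Prop :=
  [/\ forall j, j \in h.1 -> j.1 <= T,
      last_departure s h <= T + k%:R * s &
      forall (t : R) (m : nat), T < t ->
        (m < jobs_before h.1 t)%N = (t + m%:R * s <= last_departure s h)].

(** The bound on the last departure in [tracks] excludes k + 1 jobs, so the buffer
is full as soon as it holds at least k jobs. *)
Lemma full_bufferE (R : realType) (s : R) (k : nat)
    (h : seq (R * R) * seq R) (T t : R) :
  (0 < k)%N -> tracks s k h T -> T < t ->
  (jobs_before h.1 t == k) = (t + k.-1%:R * s <= last_departure s h).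
Proof.
case: k => // k _ [_ dT cnt] Tt; rewrite -(cnt t k Tt) eqn_leq.
suff -> : (jobs_before h.1 t <= k.+1)%N by [].
by rewrite leqNgt (cnt t k.+1 Tt) -ltNge (le_lt_trans dT) // ltrD2r.
Qed.

Lemma max_last_departure (R : realType) (s t : R) (h : seq (R * R) * seq R) :
  - s <= t -> Num.max t (last t (unzip2 h.1)) = Num.max t (last_departure s h).
Proof.
rewrite /last_departure; case: (unzip2 h.1) => //= st.
by rewrite maxxx (max_idPl st).
Qed.

Lemma arriveE (R : realType) (s : R) (k : nat)
    (h : seq (R * R) * seq R) (T t : R) :
  (0 < k)%N -> tracks s k h T -> - s <= T -> T < t ->
  arrive s k h t =
  if t + k.-1%:R * s <= last_departure s h then (h.1, rcons h.2 t)
  else (rcons h.1 (t, Num.max t (last_departure s h) + s), h.2).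
Proof.
move=> k0 hT sT Tt; rewrite /arrive (full_bufferE k0 hT Tt).
by rewrite (max_last_departure (s:=s)) // (le_trans sT) // ltW.
Qed.

(** An admission at [t] either starts a new busy period, with one job present
afterwards, or shifts the arithmetic progression of departures by one term. *)
Lemma tracks_arrive (R : realType) (s : R) (k : nat)
    (h : seq (R * R) * seq R) (T t : R) :
  0 < s -> (0 < k)%N -> tracks s k h T -> - s <= T -> T < t ->
  tracks s k (arrive s k h t) t.
Proof.
move=> s0 k0 hT sT Tt; rewrite (arriveE k0 hT) //.
have [jT dT cnt] := hT.
have jt j : j \in h.1 -> j.1 <= t by move=> /jT /le_trans; apply; exact: ltW.
case: leP => full.
  split => //=; first by rewrite (le_trans dT) // lerD2r ltW.
  by move=> u m tu; rewrite cnt // (lt_trans Tt).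
split => [j||u m tu] /=.
- by rewrite mem_rcons inE => /predU1P[->|/jt].
- rewrite /last_departure /unzip2 map_rcons last_rcons /=.
  rewrite -/(last_departure s h) in full *.
  have -> : k%:R * s = k.-1%:R * s + s :> R.
    by rewrite -{1}(prednK k0) -natr1 mulrDl mul1r.
  rewrite addrA lerD2r ge_max (ltW full) andbT lerDl.
  by rewrite mulr_ge0 // ltW.
- rewrite /last_departure /unzip2 map_rcons last_rcons /=.
  rewrite -/(unzip2 h.1) -/(last_departure s h) in full *.
  rewrite /jobs_before -cats1 count_cat /= -/(jobs_before h.1 u) tu addn0 /=.
  set d := last_departure s h in full cnt dT *.
  have Tu := lt_trans Tt tu.
  have c0 := cnt u 0%N Tu.
  have [dt|td] := ltP d t.
    move: c0; rewrite mul0r addr0 leNgt (lt_trans dt tu) /= => /negbT.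
    rewrite -eqn0Ngt => /eqP ->; rewrite add0n.
    case: m => [|m]; first by rewrite mul0r addr0 lt0b.
    have : 0 <= m%:R * s by rewrite mulr_ge0 // ltW.
    rewrite -natr1 mulrDl mul1r => ms.
    by case: leP => /= _; apply/esym/negbTE; rewrite -ltNge; lra.
  case: m => [|m].
    rewrite mul0r addr0; case: leP => /= [_|ud]; first by rewrite addn1.
    rewrite addn0 c0 mul0r addr0; apply/negbTE; rewrite -ltNge; lra.
  rewrite -natr1 mulrDl mul1r addrA lerD2r -cnt //.
  case: leP => /= [_|ud]; first by rewrite addn1.
  rewrite addn0; apply/idP/idP; first exact: ltnW.
  rewrite cnt // => H.
  have : 0 <= m%:R * s by rewrite mulr_ge0 // ltW.
  lra.
Qed.

Lemma le_last_path (R : realType) (a : R) (arr : seq R) :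
  path <%R a arr -> a <= last a arr.
Proof.
case/lastP: arr => [//|arr t]; rewrite last_rcons => P.
apply: ltW; move/(order_path_min lt_trans)/allP: P; apply.
by rewrite mem_rcons mem_head.
Qed.

Lemma tracks_history (R : realType) (s : R) (k : nat) (arr : seq R) :
  0 < s -> (0 < k)%N -> path <%R (- s) arr ->
  tracks s k (history s k arr) (last (- s) arr).
Proof.
move=> s0 k0; elim/last_ind: arr => [_|arr t IH].
  split => //; rewrite /last_departure /=.
    by rewrite lerDl mulr_ge0 // ltW.
  move=> t m st; apply/esym/negbTE; rewrite -ltNge.
  by rewrite (lt_le_trans st) // lerDl mulr_ge0 // ltW.
rewrite rcons_path => /andP[P lt_t].
rewrite history_rcons last_rcons; apply: tracks_arrive (IH P) _ lt_t => //.
exact: le_last_path.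
Qed.

(** * Recording the busy periods *)

(** A nominal busy period, possibly still in progress: [rest] is the beginning
of the idle period before it and [finish] the departure of its latest job. *)
Record period (R : Type) :=
  Period { rest : R; start : R; finish : R; lossy : bool }.

HB.instance Definition _ (R : Type) := gen_eqMixin (period R).

(** The default is the virtual period of the job that departs at [- s]. *)
Definition current (R : realType) (s : R) (ps : seq (period R)) : period R :=
  head (Period (- s) (- s) (- s) false) ps.

(** The most recent period comes first.  A job that arrives at the very instant
[finish] does not open a new period: no idle time separates them. *)
Definition record_arrival (R : realType) (s : R) (k : nat)
    (ps : seq (period R)) (t : R) : seq (period R) :=
  let p := current s ps in
  if finish p < t then Period (finish p) t (t + s) false :: ps
  else if t + k.-1%:R * s <= finish p
    then Period (rest p) (start p) (finish p) true :: behead ps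
    else Period (rest p) (start p) (finish p + s) (lossy p) :: behead ps.

Definition busy_periods (R : realType) (s : R) (k : nat) (arr : seq R) :
    seq (period R) :=
  foldl (record_arrival s k) [::] arr.

Definition short (R : realType) (s : R) (p : period R) : bool :=
  start p - rest p < s.

Lemma busy_periods_rcons (R : realType) (s : R) (k : nat) (arr : seq R) (t : R) :
  busy_periods s k (rcons arr t) = record_arrival s k (busy_periods s k arr) t.
Proof. by rewrite /busy_periods foldl_rcons. Qed.

Fixpoint chained (R : realType) (s : R) (ps : seq (period R)) : bool :=
  if ps is p :: qs then
    [&& rest p == finish (current s qs), rest p < start p, start p < finish p
      & chained s qs]
  else true.

Definition serving (R : realType) (u : R) (p : period R) : bool :=
  start p <= u < finish p.

(** The losses of a period lie in the half-open interval ending at [finish]: a job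
that departs at [t] still occupies the queue for an arrival at [t]. *)
Definition agrees (R : realType) (s : R) (ps : seq (period R))
    (h : seq (R * R) * seq R) (T : R) : Prop :=
  [/\ finish (current s ps) = last_departure s h,
      chained s ps,
      forall p, p \in ps -> 0 <= start p <= T,
      forall u, (0 < jobs_at h.1 u)%N = has (serving u) ps &
      forall p, p \in ps -> lossy p ->
        exists2 t, t \in h.2 & start p < t <= finish p] /\
      forall t, t \in h.2 ->
        exists p, [/\ p \in ps, lossy p & start p < t <= finish p].

Lemma agrees_record_arrival (R : realType) (s : R) (k : nat) (ps : seq (period R))
    (h : seq (R * R) * seq R) (T t : R) :
  0 < s -> (0 < k)%N -> tracks s k h T -> - s <= T -> T < t -> 0 <= t ->
  agrees s ps h T -> agrees s (record_arrival s k ps t) (arrive s k h t) t.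
Proof.
move=> s0 k0 hT sT Tt t0 [[dE chain startT busyE lost1] lost2].
rewrite (arriveE k0 hT) // /record_arrival dE.
set d := last_departure s h in dE *.
have ks : 0 <= k.-1%:R * s by rewrite mulr_ge0 // ltW.
have at_rcons (u e : R) : jobs_at (rcons h.1 (t, e)) u
    = (jobs_at h.1 u + (t <= u < e)%R)%N.
  by rewrite /jobs_at -cats1 count_cat /= addn0.
have startt p : p \in ps -> 0 <= start p <= t.
  by move/startT/andP => -[-> /le_trans]; apply; exact: ltW.
have dep_rcons e : last_departure s (rcons h.1 (t, e), h.2) = e.
  by rewrite /last_departure /unzip2 map_rcons last_rcons.
have [dt|td] := ltP d t.
  have -> : (t + k.-1%:R * s <= d) = false by apply/negbTE; rewrite -ltNge; lra.
  split.
    split => /=.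
    - by rewrite dep_rcons.
    - by rewrite chain dE eqxx dt ltrDl s0.
    - by move=> p; rewrite inE => /predU1P[->|/startt//] /=; rewrite t0 lexx.
    - by move=> u; rewrite at_rcons addn_gt0 busyE lt0b orbC.
    - by move=> p; rewrite inE => /predU1P[-> //|]; exact: lost1.
  move=> u /lost2[p [pps lp up]]; exists p; split => //.
  by rewrite inE pps orbT.
case: ps dE chain startT busyE lost1 lost2 startt => [|p qs] dE chain startT busyE lost1 lost2 startt.
  by exfalso; move: dE => /= dE; lra.
(* The arrival falls into the latest period [p], which becomes lossy or longer. *)
move: dE chain => /= dE /and4P[/eqP rp rs sf chain].
have /andP[_ pt] := startT p (mem_head _ _).
have [full|free] := leP (t + k.-1%:R * s) d.
  split.
    split => //=.
    - by rewrite -rp eqxx rs chain -dE sf.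
    - move=> q; rewrite inE => /predU1P[->|qqs] /=; apply: startt.
        by rewrite mem_head.
      by rewrite inE qqs orbT.
    - by move=> u; rewrite busyE /= /serving /= dE.
    - move=> q; rewrite inE => /predU1P[->|qqs] /= lq.
        exists t; first by rewrite mem_rcons mem_head.
        by rewrite td andbT (le_lt_trans pt).
      have [|u u1 u2] := lost1 q _ lq; first by rewrite inE qqs orbT.
      by exists u => //; rewrite mem_rcons inE u1 orbT.
  move=> u; rewrite mem_rcons inE => /predU1P[->|/lost2[q [qps lq uq]]].
    exists (Period (rest p) (start p) d true); split => //=.
      by rewrite mem_head.
    by rewrite td andbT (le_lt_trans pt).
  move: qps; rewrite inE => /predU1P[qp|qqs]; last first.
    by exists q; split => //; rewrite inE qqs orbT.
  exists (Period (rest p) (start p) d true); split => //=.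
    by rewrite mem_head.
  by rewrite -dE -qp.
split.
  split => //=.
  - by rewrite -rp eqxx rs chain -dE ltr_wpDr // ltW.
  - move=> q; rewrite inE => /predU1P[->|qqs] /=; apply: startt.
      by rewrite mem_head.
    by rewrite inE qqs orbT.
  - move=> u; rewrite at_rcons addn_gt0 busyE lt0b /= orbAC; congr (_ || _).
    rewrite /serving /= dE; apply/idP/idP.
      by move=> /orP[] /andP[u1 u2]; apply/andP; split; lra.
    by case/andP=> u1 u2; apply/orP; case: (ltP u d) => ud; [left|right];
      apply/andP; split; lra.
  - move=> q; rewrite inE => /predU1P[->|qqs] /= lq.
      have [|u u1 /andP[u2 u3]] := lost1 p _ lq; first by rewrite mem_head.
      by exists u => //; rewrite u2 /=; lra.
    by apply: lost1 => //; rewrite inE qqs orbT.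
move=> u /lost2[q [+ lq /andP[u1 u2]]].
rewrite inE => /predU1P[qp|qqs].
  exists (Period (rest p) (start p) (d + s) (lossy p)); split => /=.
  - by rewrite mem_head.
  - by rewrite -qp.
  - by rewrite -qp u1 /=; rewrite qp in u2; lra.
by exists q; split => //; rewrite ?u1 // inE qqs orbT.
Qed.

Lemma agrees_busy_periods (R : realType) (s : R) (k : nat) (arr : seq R) :
  0 < s -> (0 < k)%N -> path <%R (- s) arr -> {in arr, forall a, 0 <= a} ->
  agrees s (busy_periods s k arr) (history s k arr) (last (- s) arr).
Proof.
move=> s0 k0; elim/last_ind: arr => [_ _|arr t IH].
  by split.
rewrite rcons_path => /andP[P lt_t] ge0.
rewrite history_rcons busy_periods_rcons last_rcons.
apply: (agrees_record_arrival s0 k0 (tracks_history s0 k0 P)) => //.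
- exact: le_last_path.
- by apply: ge0; rewrite mem_rcons mem_head.
- by apply: IH => // a aarr; apply: ge0; rewrite mem_rcons inE aarr orbT.
Qed.

(** * The amortized comparison of the two queues *)

(** The state of the comparison inside a nominal busy period: [D] is the lag of
the last departure of the larger queue, [l] and [sh] tell whether the current
period is lossy so far and whether its preceding idle period is short, [lost] and
[lost'] count the losses of the two queues, and the last two arguments count the
lossy periods and the short ones among them.  With G = lost - lost', the second
clause is G <= N, strict while a lossy period may still gain a loss; the third
is N - G <= N_s, strict when the lag may still cost a loss.  The last two clauses
say what pays for the current period if it becomes lossy without any gain. *)
Definition balanced (R : realType) (s D : R) (l sh : bool)
    (lost lost' all_lossy short_lossy : nat) : Prop :=
  [/\ 0 <= D < s + s,
      (lost + (l && (D < s)%R) <= all_lossy + lost')%N,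
      (all_lossy + lost' + ((s < D) || ~~ l && (s <= D))%R
         <= short_lossy + lost)%N,
      ~~ l -> s <= D -> sh &
      ~~ l -> 0 < D -> sh || (all_lossy + lost' < short_lossy + lost)%N].

(** A new period reopens the possibility of a failed gain, but only if [D > g].
If [g < s] the idle period is short and pays for it; otherwise [D > s], and the
third clause has already provided the payment. *)
Lemma balanced_idle (R : realType) (s D g : R) l sh n n' a b :
  0 < s -> 0 < g -> balanced s D l sh n n' a b ->
  balanced s (Num.max 0 (D - g)) false (g < s) n n' a b.
Proof.
move=> s0 g0 [/andP[D0 D2] Up Lo _ _].
have le_a : (a + n' <= b + n)%N by move: Lo; lia.
have lt_a : s < D -> (a + n' < b + n)%N by move=> sD; move: Lo; rewrite sD; lia.
split => /=.
- by case: (leP 0 (D - g)) => ?; apply/andP; split; lra.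
- by move: Up; lia.
- have [sD|Ds] := ltP s D; first by have := lt_a sD; lia.
  have /negbTE -> : ~~ (s < Num.max 0 (D - g)).
    by rewrite -leNgt; case: (leP 0 (D - g)) => ?; lra.
  have /negbTE -> : ~~ (s <= Num.max 0 (D - g)).
    by rewrite -ltNge; case: (leP 0 (D - g)) => ?; lra.
  by rewrite addn0.
- by move=> _; case: (leP 0 (D - g)) => ? ?; lra.
- move=> _; have [//|sg] := ltP g s.
  by case: (leP 0 (D - g)) => ? ?; [apply: lt_a; lra|exfalso; lra].
Qed.

(** The first such loss in a period is paid by the period becoming lossy; a later
one is allowed by the strictness of the second clause. *)
Lemma balanced_lost_nominal (R : realType) (s D : R) l sh n n' a b :
  0 < s -> D < s -> balanced s D l sh n n' a b ->
  balanced s (D + s) true sh n.+1 n' (a + ~~ l) (b + (~~ l && sh)).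
Proof.
move=> s0 Ds [/andP[D0 _] Up Lo _ Cr].
move: Up Lo; rewrite Ds (ltNge s D) (leNgt s D) Ds (ltW Ds) /= andbF andbT addn0.
move=> Up Lo; split => //=; first by apply/andP; split; lra.
- by rewrite (ltNge _ s) lerDr D0; case: l Up Lo Cr => /=; lia.
- rewrite ltrDr orbF; case: l Up Lo Cr => /= Up Lo Cr; first by lia.
  by case: ltP => [/(Cr isT)|_]; case: (sh) => /=; lia.
Qed.

(** A common first loss makes the period lossy without any gain.  As [0 < D], the
last clause of [balanced] supplies the payment. *)
Lemma balanced_lost_both (R : realType) (s D : R) l sh n n' a b :
  0 < s -> 0 < D -> balanced s D l sh n n' a b ->
  balanced s D true sh n.+1 n'.+1 (a + ~~ l) (b + (~~ l && sh)).
Proof.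
move=> s0 D0 [/andP[_ D2] Up Lo sh_D Cr].
split => //=; first by rewrite (ltW D0).
- by case: (l) Up; case: (D < s) => /=; lia.
- case: l Up Lo sh_D Cr => /= Up Lo sh_D Cr; first by lia.
  have := Cr isT D0; have := sh_D isT; move: Lo; case: (ltgtP s D) => sD /=.
  + by move=> ? /(_ isT) -> _ /=; lia.
  + by move=> ? _; case: (sh) => /=; lia.
  + by move=> ? /(_ isT) -> _ /=; lia.
Qed.

(** The extra loss of the larger queue is paid by the strictness of the third
clause, and the lag falls back below [s]. *)
Lemma balanced_lost_perturbed (R : realType) (s D : R) l sh n n' a b :
  0 < s -> (s < D) || ~~ l && (s <= D) -> balanced s D l sh n n' a b ->
  balanced s (D - s) l sh n n'.+1 a b.
Proof.
move=> s0 sD [/andP[_ D2] Up]; rewrite sD => Lo sh_D Cr.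
have sD' : s <= D by case/orP: sD => [/ltW//|/andP[]].
split => //=; first by apply/andP; split; lra.
- by move: Up; case: (l && _); case: (l && _) => /=; lia.
- rewrite (_ : s < D - s = false); last by apply/negbTE; rewrite -leNgt; lra.
  rewrite (_ : s <= D - s = false); last by apply/negbTE; rewrite -ltNge; lra.
  by rewrite andbF /=; lia.
- by move=> /sh_D /(_ sD').
- by move=> /sh_D /(_ sD') ->.
Qed.

Definition short_lossy (R : realType) (s : R) (p : period R) : bool :=
  lossy p && short s p.

Definition coupled (R : realType) (s : R) (ps : seq (period R))
    (h h' : seq (R * R) * seq R) : Prop :=
  balanced s (last_departure s h' - last_departure s h)
    (lossy (current s ps)) (short s (current s ps)) (size h.2) (size h'.2)
    (count (@lossy R) ps) (count (short_lossy s) ps).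

Lemma last_departure_rcons (R : realType) (s t e : R) (g : seq (R * R)) (l : seq R) :
  last_departure s (rcons g (t, e), l) = e.
Proof. by rewrite /last_departure /unzip2 map_rcons last_rcons. Qed.

(** Which of the four transitions occurs is decided by comparing [d] with
t + (k - 1)s and [d'] with t + ks.  As these thresholds differ by s and
d < t + ks, each outcome bounds the lag [d' - d] as the transition requires. *)
Lemma coupled_arrive (R : realType) (s : R) (k : nat) (ps : seq (period R))
    (h h' : seq (R * R) * seq R) (T t : R) :
  0 < s -> (0 < k)%N -> tracks s k h T -> tracks s k.+1 h' T ->
  - s <= T -> T < t -> 0 <= t -> finish (current s ps) = last_departure s h ->
  coupled s ps h h' ->
  coupled s (record_arrival s k ps t) (arrive s k h t) (arrive s k.+1 h' t).
Proof.
move=> s0 k0 hT hT' sT Tt t0 dE.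
have dk : last_departure s h < t + k%:R * s.
  by have [_ /le_lt_trans -> //] := hT; rewrite ltrD2r.
rewrite (arriveE k0 hT) // (arriveE (ltn0Sn k) hT') // /record_arrival dE.
rewrite succnK.
have kE : k%:R * s = k.-1%:R * s + s :> R.
  by rewrite -{1}(prednK k0) -natr1 mulrDl mul1r.
rewrite kE in dk *.
have : 0 <= k.-1%:R * s by rewrite mulr_ge0 // ltW.
move: (k.-1%:R * s) dk => K dk K0 {kE hT hT'}.
rewrite /coupled; case: h h' dE dk => [g n] [g' n'].
set d := last_departure s (g, n); set d' := last_departure s (g', n').
move=> dE dk bal; have /andP[D0 D2] : 0 <= d' - d < s + s by case: bal.
have [dt|td] := ltP d t.
  have -> : (t + K <= d) = false by apply/negbTE; rewrite -ltNge; lra.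
  (* The larger queue may lose the job that opens a nominal busy period: this is
     the transition of an extra loss, taken right after the idle period. *)
  have := balanced_idle s0 _ bal; move=> /(_ (t - d)).
  rewrite subr_gt0 => /(_ dt) {}bal.
  rewrite last_departure_rcons.
  have [full'|free'] := leP (t + (K + s)) d'.
    have D1 : s <= Num.max 0 (d' - d - (t - d)) by case: (leP 0 (d' - d - (t - d))) => ?; lra.
    have := balanced_lost_perturbed s0 _ bal.
    rewrite /= D1 orbT => /(_ isT).
    rewrite (_ : _ - s = d' - (t + s)); last by case: (leP 0 (d' - d - (t - d))) => ?; lra.
    by rewrite size_rcons /= add0n.
  rewrite last_departure_rcons.
  rewrite (_ : _ - (t + s) = Num.max 0 (d' - d - (t - d))) /=; first by rewrite add0n.
  by case: (leP 0 (d' - d - (t - d))) => ?; case: (leP t d') => ?; lra.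
case: ps dE bal => [/= dE|p qs /= dE bal]; first by exfalso; lra.
have [full|free] := leP (t + K) d; have [full'|free'] := leP (t + (K + s)) d'.
- have := balanced_lost_both s0 _ bal => /(_ _)/=.
  rewrite !size_rcons.
  have Dp : 0 < d' - d by lra.
  move=> /(_ Dp); rewrite /short_lossy /short /=.
  by case: (lossy p) => /=; rewrite ?addn0 // !add0n addn1 (addnC (count _ qs)).
- have Ds : d' - d < s by lra.
  have := balanced_lost_nominal s0 Ds bal.
  rewrite last_departure_rcons size_rcons /short_lossy /short /= max_r; last by lra.
  rewrite (addrAC d').
  by case: (lossy p) => /=; rewrite ?addn0 // !add0n addn1 (addnC (count _ qs)).
- have Ds : s < d' - d by lra.
  have := balanced_lost_perturbed s0 _ bal; rewrite Ds => /(_ isT).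
  rewrite last_departure_rcons size_rcons /short_lossy /short /=.
  by rewrite opprD addrA.
- rewrite !last_departure_rcons !max_r; [|lra..].
  by rewrite /short_lossy /short /= opprD addrACA subrr addr0.
Qed.

Lemma coupled_histories (R : realType) (s : R) (k : nat) (arr : seq R) :
  0 < s -> (0 < k)%N -> path <%R (- s) arr -> {in arr, forall a, 0 <= a} ->
  coupled s (busy_periods s k arr) (history s k arr) (history s k.+1 arr).
Proof.
move=> s0 k0; elim/last_ind: arr => [_ _|arr t IH].
  rewrite /coupled /last_departure /= subrr.
  have [s_lt0 s_le0] : (s < 0 = false) /\ (s <= 0 = false).
    by rewrite (ltNge s) (leNgt s) s0 ltW.
  by split; rewrite ?s_lt0 ?s_le0 ?ltxx ?lexx ?addr_gt0.
rewrite rcons_path => /andP[P lt_t] ge0.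
have ge0' : {in arr, forall a, 0 <= a}.
  by move=> a aarr; apply: ge0; rewrite mem_rcons inE aarr orbT.
rewrite !history_rcons busy_periods_rcons.
apply: (coupled_arrive s0 k0 (tracks_history s0 k0 P) (tracks_history s0 _ P)) => //.
- exact: le_last_path.
- by apply: ge0; rewrite mem_rcons mem_head.
- by have [[-> ]] := agrees_busy_periods s0 k0 P ge0'.
- exact: IH.
Qed.

Local Open Scope classical_set_scope.

(** * Busy and idle periods as maximal intervals *)

(** The union of two intervals that meet is an interval. *)
Lemma maximal_interval_meet (R : realType) (D I J : set R) (t : R) :
  maximal_interval_in D I -> maximal_interval_in D J -> I t -> J t -> I = J.
Proof.
move=> [_ Iitv ID Imax] [_ Jitv JD Jmax] It Jt.
have IJitv : is_interval (I `|` J).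
  move=> u v uIJ vIJ z /andP[uz zv].
  have [zt|tz] := leP z t.
    by case: uIJ => [Iu|Ju]; [left; apply: (Iitv u t)|right; apply: (Jitv u t)]; rewrite // uz.
  by case: vIJ => [Iv|Jv]; [left; apply: (Iitv t v)|right; apply: (Jitv t v)]; rewrite // zv ltW.
have IJD : I `|` J `<=` D by rewrite subUset.
have eI := Imax _ IJitv IJD (@subsetUl _ I J).
by have eJ := Jmax _ IJitv IJD (@subsetUr _ I J); rewrite -{1}eI.
Qed.

Lemma chained_le_rest (R : realType) (s : R) (p q : period R) (ps : seq (period R)) :
  chained s (p :: ps) -> q \in ps -> finish q <= rest p.
Proof.
elim: ps p => //= r ps IH p /and4P[/eqP -> _ _ /[dup] ch /and4P[_ rs sf _]].
rewrite inE => /predU1P[-> //|qps].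
by rewrite (le_trans (IH _ ch qps)) // ltW // (lt_trans rs).
Qed.

Lemma chained_mem (R : realType) (s : R) (p : period R) (ps : seq (period R)) :
  chained s ps -> p \in ps -> rest p < start p < finish p.
Proof.
elim: ps => //= r ps IH /and4P[_ rs sf ch].
by rewrite inE => /predU1P[->|/IH->//]; rewrite rs.
Qed.

Lemma chained_separated (R : realType) (s : R) (p q : period R)
    (ps : seq (period R)) :
  chained s ps -> p \in ps -> q \in ps ->
  [\/ p = q, finish p < start q | finish q < start p].
Proof.
elim: ps => // r ps IH /[dup] ch /= /and4P[_ rs sf ch'].
rewrite !inE => /predU1P[->|pps] /predU1P[->|qps].
- by constructor 1.
- by constructor 3; rewrite (le_lt_trans (chained_le_rest ch qps)).
- by constructor 2; rewrite (le_lt_trans (chained_le_rest ch pps)).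
- exact: IH.
Qed.

Lemma chained_idle (R : realType) (s : R) (p q : period R)
    (ps : seq (period R)) :
  chained s ps -> p \in ps -> q \in ps ->
  finish q <= rest p \/ start p <= start q.
Proof.
elim: ps => // r ps IH /[dup] ch /= /and4P[_ rs sf ch'].
rewrite !inE => /predU1P[->|pps] /predU1P[->|qps].
- by right.
- by left; apply: chained_le_rest ch qps.
- right; have := chained_le_rest ch pps.
  by have /andP[_] := chained_mem ch' pps; lra.
- exact: IH.
Qed.

Lemma chained_uniq (R : realType) (s : R) (ps : seq (period R)) :
  chained s ps -> uniq ps.
Proof.
elim: ps => // p ps IH /[dup] ch /= /and4P[_ rs sf /IH ->]; rewrite andbT.
by apply/negP => /(chained_le_rest ch); lra.
Qed.

Lemma short_has_previous (R : realType) (s : R) (p : period R)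
    (ps : seq (period R)) :
  chained s ps -> p \in ps -> 0 <= start p -> short s p ->
  exists2 q, q \in ps & finish q = rest p.
Proof.
elim: ps => // r ps IH /= /and4P[/eqP rr _ _ ch].
rewrite inE => /predU1P[->|pps] r0.
  rewrite /short rr; case: ps {IH rr ch} => [|q ps] /= sh; first by exfalso; lra.
  by exists q; rewrite // !inE eqxx orbT.
by move=> /(IH ch pps r0)[q qps qp]; exists q; rewrite // inE qps orbT.
Qed.

(** The truncation matters for the last period only, which may be unfinished at
the horizon. *)
Definition busy_interval (R : realType) (tf : R) (p : period R) : set R :=
  [set u | start p <= u < finish p /\ u <= tf].

Definition starts_within (R : realType) (tf : R) (ps : seq (period R)) : Prop :=
  forall p, p \in ps -> 0 <= start p <= tf.

Lemma busy_interval_start (R : realType) (s tf : R) (ps : seq (period R)) p :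
  chained s ps -> starts_within tf ps -> p \in ps -> busy_interval tf p (start p).
Proof.
move=> ch tm pps; have /andP[_ sf] := chained_mem ch pps.
by have /andP[_ ptf] := tm _ pps; split => //; rewrite lexx.
Qed.

Lemma maximal_busy_interval (R : realType) (s tf : R) (ps : seq (period R)) p :
  chained s ps -> starts_within tf ps -> p \in ps ->
  maximal_interval_in [set u | 0 <= u <= tf /\ has (serving u) ps]
    (busy_interval tf p).
Proof.
move=> ch tm pps; have Ip := busy_interval_start ch tm pps.
have p0 : 0 <= start p by have /andP[] := tm _ pps.
split; first by exists (start p).
- move=> u v [/andP[u1 _] _] [/andP[_ v1] v2] z /andP[uz zv].
  by split; [apply/andP; split|]; lra.
- move=> u [/andP[u1 u2] u3]; split; first by apply/andP; split; lra.
  by apply/hasP; exists p; rewrite // /serving u1 u2.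
move=> J Jitv JD IJ; apply/seteqP; split => // v Jv.
(* A point of J outside p would make J contain the finish of some period, but
   successive periods are separated by positive idle times. *)
have gap q : q \in ps -> ~ J (finish q).
  move=> qps /JD[_ /hasP[r rps /andP[r1 r2]]].
  have /andP[_ qf] := chained_mem ch qps.
  by have [rq|?|?] := chained_separated ch rps qps; [rewrite rq in r2| |]; lra.
have [/andP[_ vtf] /hasP[q qps /andP[q1 q2]]] := JD _ Jv.
have Jp := IJ _ Ip.
have [pq|pq|qp] := chained_separated ch pps qps.
- by split => //; rewrite pq q1 q2.
- case: (gap p pps); apply: (Jitv _ _ Jp Jv).
  by have /andP[_ ?] := chained_mem ch pps; apply/andP; split; lra.
- case: (gap q qps); apply: (Jitv _ _ Jv Jp).
  by apply/andP; split; lra.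
Qed.

(** Shortness excludes the first period, whose [rest] is the virtual departure
time [- s], outside the horizon. *)
Lemma maximal_idle_interval (R : realType) (s tf : R) (ps : seq (period R)) p :
  chained s ps -> starts_within tf ps -> p \in ps -> short s p ->
  maximal_interval_in [set u | 0 <= u <= tf /\ ~~ has (serving u) ps]
    `[rest p, start p[.
Proof.
move=> ch tm pps sh; have /andP[rp sp] := chained_mem ch pps.
have /andP[p0 ptf] := tm _ pps.
have [q qps qp] := short_has_previous ch pps p0 sh.
have /andP[q0 _] := tm _ qps; have /andP[_ qf] := chained_mem ch qps.
have Jr : `[rest p, start p[ (rest p) by rewrite /= in_itv /= lexx.
split; first by exists (rest p).
- exact: interval_is_interval.
- move=> u; rewrite /= in_itv /= => /andP[u1 u2]; split.
    by apply/andP; split; lra.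
  apply/hasPn => r rps; apply/negP => /andP[r1 r2].
  by case: (chained_idle ch pps rps); lra.
(* To the left J would reach into the period that ends at [rest p], to the right
   into p itself. *)
move=> J Jitv JD IJ; apply/seteqP; split => // v Jv.
rewrite /= in_itv /=; apply/andP; split.
- rewrite leNgt; apply/negP => vr.
  have /(_ _)/JD[] := Jitv _ _ Jv (IJ _ Jr) (Num.max v (start q)).
    by case: (leP v (start q)) => ?; rewrite ?lexx ?andbT /=; try (apply/andP; split); lra.
  move=> _ /hasPn /(_ _ qps); apply/negP; rewrite negbK /serving.
  by case: (leP v (start q)) => ?; apply/andP; split; lra.
- rewrite ltNge; apply/negP => vs.
  have /(_ _)/JD[] := Jitv _ _ (IJ _ Jr) Jv (start p).
    by rewrite vs andbT ltW.
  by move=> _ /hasPn /(_ _ pps); rewrite /serving lexx sp.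
Qed.

Lemma busy_interval_inj (R : realType) (s tf : R) (ps : seq (period R)) :
  chained s ps -> starts_within tf ps -> {in ps &, injective (busy_interval tf)}.
Proof.
move=> ch tm p q pps qps eqI; have := busy_interval_start ch tm pps.
rewrite {}eqI => -[/andP[q1 q2] _].
have /andP[_ sf] := chained_mem ch pps.
by have [//|?|?] := chained_separated ch pps qps; exfalso; lra.
Qed.

Lemma inf_busy_interval (R : realType) (s tf : R) (ps : seq (period R)) p :
  chained s ps -> starts_within tf ps -> p \in ps ->
  inf (busy_interval tf p) = start p.
Proof.
move=> ch tm pps; have Ip := busy_interval_start ch tm pps.
have lb : lbound (busy_interval tf p) (start p) by move=> u [/andP[]].
apply/le_anti/andP; split; first by apply: ge_inf => //; exists (start p).
by apply: lb_le_inf => //; exists (start p).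
Qed.

(** Losses are located by the closure of a busy period; closures of distinct
periods stay disjoint since the idle times between them are positive. *)
Lemma closure_busy_interval (R : realType) (tf : R) (p : period R) (t : R) :
  closure (busy_interval tf p) t -> start p <= t <= finish p.
Proof.
have sub : busy_interval tf p `<=` `[start p, finish p].
  by move=> u [/andP[u1 u2] _]; rewrite /= in_itv /= u1 ltW.
move=> /(closureS sub); rewrite -(closure_id _).1; last exact: interval_closed.
by rewrite /= in_itv.
Qed.

Lemma mem_closure_busy_interval (R : realType) (tf : R) (p : period R) (t : R) :
  start p < t <= finish p -> t <= tf -> closure (busy_interval tf p) t.
Proof.
move=> /andP[pt tp] ttf B Bt.
have : \forall u \near t^'-, [/\ start p < u, u < t & B u].
  near=> u; split; near: u; [exact: nbhs_left_gt|exact: nbhs_left_lt|].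
  exact: cvg_within Bt.
move=> /filter_ex[u [u1 u2 Bu]]; exists u; split => //.
by split; [apply/andP; split|]; lra.
Unshelve. all: by end_near. Qed.

(** * Counting the lossy periods *)

Lemma card_fset_set_seq (T : choiceType) (r : seq T) :
  uniq r -> #|` fset_set [set` r]|%fset = size r.
Proof.
move=> ur; have -> : [set` r] = [set` [fset y in r]%fset].
  by apply/seteqP; split => y /=; rewrite inE.
by rewrite set_fsetK card_fseq undup_id.
Qed.

(** All that the count of the lossy periods uses of the list [ps]. *)
Definition describes (R : realType) (s tf : R) (k : nat) (arr : seq R)
    (ps : seq (period R)) : Prop :=
  [/\ chained s ps, starts_within tf ps,
      forall u, (0 < x s arr k u)%N = has (serving u) ps,
      forall p, p \in ps -> lossy p ->
        exists2 t, t \in lost_jobs s k arr & start p < t <= finish p /\ t <= tf &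
      forall t, t \in lost_jobs s k arr ->
        exists p, [/\ p \in ps, lossy p & start p < t <= finish p]].

Lemma busy_set (R : realType) (s tf : R) (k : nat) (arr : seq R) ps :
  describes s tf k arr ps ->
  [set u | 0 <= u <= tf /\ (0 < x s arr k u)%N] =
  [set u | 0 <= u <= tf /\ has (serving u) ps].
Proof.
by move=> [_ _ xE _ _]; apply/seteqP; split => u [? ?]; split => //;
  rewrite /= ?xE // -xE.
Qed.

Lemma idle_set (R : realType) (s tf : R) (k : nat) (arr : seq R) ps :
  describes s tf k arr ps ->
  [set u | 0 <= u <= tf /\ x s arr k u = 0%N] =
  [set u | 0 <= u <= tf /\ ~~ has (serving u) ps].
Proof.
move=> [_ _ xE _ _]; apply/seteqP; split => u [u0 xu]; split => //.
  by rewrite -xE xu.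
by move: xu; rewrite -xE -eqn0Ngt => /eqP.
Qed.

Lemma lossy_busy_periodE (R : realType) (s tf : R) (k : nat) (arr : seq R) ps :
  describes s tf k arr ps ->
  [set I | lossy_busy_period s tf arr k I] =
  [set` map (busy_interval tf) [seq p <- ps | lossy p]].
Proof.
move=> sim; have [ch tm xE lost1 lost2] := sim.
apply/seteqP; split => I /=.
  rewrite /lossy_busy_period /busy_period (busy_set sim) => -[maxI [t lost It]].
  have [[u Iu] _ ID _] := maxI.
  have [/andP[_ utf] /hasP[p pps pu]] := ID _ Iu.
  have eI : I = busy_interval tf p.
    exact: maximal_interval_meet maxI (maximal_busy_interval ch tm pps) Iu (conj pu utf).
  apply/mapP; exists p => //; rewrite mem_filter pps andbT.
  have [q [qps lq /andP[q1 q2]]] := lost2 _ lost.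
  move: It; rewrite eI => /closure_busy_interval/andP[p1 p2] {eI ID Iu maxI lost xE}.
  have [-> //|?|?] := chained_separated ch pps qps; exfalso; lra.
move=> /mapP[p]; rewrite mem_filter => /andP[lp pps] ->.
split; first by rewrite /busy_period (busy_set sim); exact: maximal_busy_interval ch tm pps.
have [t lost [pt ttf]] := lost1 _ pps lp; exists t => //.
exact: mem_closure_busy_interval.
Qed.

Lemma N_count (R : realType) (s tf : R) (k : nat) (arr : seq R) ps :
  describes s tf k arr ps -> N s tf arr k = count (@lossy R) ps.
Proof.
move=> sim; have [ch tm _ _ _] := sim.
rewrite /N (lossy_busy_periodE sim) card_fset_set_seq ?size_map ?size_filter //.
rewrite map_inj_in_uniq ?filter_uniq ?(chained_uniq ch) //.
by move=> p q; rewrite !mem_filter => /andP[_ pps] /andP[_ qps];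
  exact: (busy_interval_inj ch tm pps qps).
Qed.

(** An inequality suffices, since N_s only appears in the upper bound: each short
lossy period of the list is exhibited with its idle interval. *)
Lemma N_s_count (R : realType) (s tf : R) (k : nat) (arr : seq R) ps :
  describes s tf k arr ps -> (count (short_lossy s) ps <= N_s s tf arr k)%N.
Proof.
move=> sim; have [ch tm _ _ _] := sim.
have uniqS : uniq (map (busy_interval tf) [seq p <- ps | short_lossy s p]).
  rewrite map_inj_in_uniq ?filter_uniq ?(chained_uniq ch) //.
  by move=> p q; rewrite !mem_filter => /andP[_ pps] /andP[_ qps];
    exact: (busy_interval_inj ch tm pps qps).
rewrite -size_filter -(size_map (busy_interval tf)) -(card_fset_set_seq uniqS).
apply: fsubset_leq_card; rewrite -fset_set_sub; last 2 first.
- exact: finite_seq.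
- apply: (@sub_finite_set _ _ [set I | lossy_busy_period s tf arr k I]).
    by move=> I [].
  by rewrite (lossy_busy_periodE sim); exact: finite_seq.
move=> I /= /mapP[p]; rewrite mem_filter => /andP[/andP[lp sh] pps] ->.
have lossyI : [set I | lossy_busy_period s tf arr k I] (busy_interval tf p).
  by rewrite (lossy_busy_periodE sim) /=; apply/map_f; rewrite mem_filter lp.
split => //; have /andP[rp _] := chained_mem ch pps.
exists `[rest p, start p[; last by rewrite sup_itv ?inf_itv.
split; last by rewrite sup_itv // (inf_busy_interval ch tm pps).
by rewrite /idle_period (idle_set sim); exact: maximal_idle_interval ch tm pps sh.
Qed.

Lemma lost_jobs_sub (R : realType) (s : R) (k : nat) (arr : seq R) :
  {subset lost_jobs s k arr <= arr}.
Proof.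
rewrite /lost_jobs; elim/last_ind: arr => // arr t IH u.
rewrite history_rcons /arrive mem_rcons inE; case: ifP => _ /=.
  by rewrite mem_rcons inE => /predU1P[->|/IH ->]; rewrite ?eqxx ?orbT.
by move=> /IH ->; rewrite orbT.
Qed.

Lemma describes_busy_periods (R : realType) (s tf : R) (k : nat) (arr : seq R) :
  0 < s -> 0 <= tf -> (0 < k)%N -> path <%R (- s) arr ->
  (forall a, a \in arr -> 0 <= a <= tf) ->
  describes s tf k arr (busy_periods s k arr).
Proof.
move=> s0 tf0 k0 P arr_tf.
have ge0 : {in arr, forall a, 0 <= a} by move=> a /arr_tf/andP[].
have [[_ ch tm xE lost1] lost2] := agrees_busy_periods s0 k0 P ge0.
split => // [p /tm/andP[-> pT]|p pps lp].
  rewrite (le_trans pT) //; have := mem_last (- s) arr.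
  by rewrite inE => /predU1P[->|/arr_tf/andP[] //]; lra.
have [t lost pt] := lost1 p pps lp; exists t => //; split => //.
by have /lost_jobs_sub/arr_tf/andP[] := lost.
Qed.

Theorem proposition1 (R : realType) (s tf : R) (arr : seq R) (k : nat)
    (s_gt0 : 0 < s) (tf_ge0 : 0 <= tf) (k_ge1 : (1 <= k)%N)
    (arr_increasing : sorted (fun a b : R => a < b) arr)
    (arr_horizon : forall a : R, a \in arr -> 0 <= a <= tf) :
  E s tf arr k <= s * (N_s s tf arr k)%:R.
Proof.
have P : path <%R (- s) arr.
  rewrite path_sortedE; last exact: lt_trans.
  rewrite arr_increasing andbT; apply/allP => a /arr_horizon/andP[a0 _].
  by rewrite (lt_le_trans _ a0) // oppr_lt0.
have ge0 : {in arr, forall a, 0 <= a} by move=> a /arr_horizon/andP[].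
have sim := describes_busy_periods s_gt0 tf_ge0 k_ge1 P arr_horizon.
have [_ Up Lo _ _] := coupled_histories s_gt0 k_ge1 P ge0.
have Ns := N_s_count sim.
rewrite /E /Delta_L /loss_volume /ipa_derivative (N_count sim) /lost_jobs.
move: Up Lo Ns => /(leq_trans (leq_addr _ _)) Up /(leq_trans (leq_addr _ _)) Lo Ns.
move: Up (leq_trans Lo (leq_add Ns (leqnn _))).
rewrite -(ler_nat R) -(ler_nat R (_ + _)%N) !natrD => Up {}Lo.
rewrite mulNr opprK -mulrBr -mulrDr normrM (gtr0_norm s_gt0) ler_pM2l //.
by rewrite ler_norml; apply/andP; split; lra.
Qed.
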